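(* For any positive integer $n$, we have $$f(n)\leq n+1,$$ and equality holds if there exists a Hadamard matrix of order $n$.
   Context: For a positive integer $n$ let $\Omega=\{1,2,\ldots,n\}$ be the sample space with $n$ sample points, with the classical (uniform) probability $\mathbb{P}(A)=|A|/n$ for every event $A\subseteq\Omega$. Two events $A,B\subseteq\Omega$ are independent if $\mathbb{P}(A\cap B)=\mathbb{P}(A)\mathbb{P}(B)$, i.e. $|A\cap B|=n^{-1}|A||B|$. Distinct events $A_1,\ldots,A_t\subseteq\Omega$ are pairwise independent if $A_i$ and $A_j$ are independent for all $1\leq i<j\leq t$. The number $f(n)$ denotes the maximum number $t$ of distinct pairwise independent events in $\Omega$ (the events $\emptyset$ and $\Omega$ are allowed). A Hadamard matrix of order $n$ is an $n\times n$ matrix $H$ with all entries in $\{1,-1\}$ such that $HH^\top=nI_n$, where $I_n$ is the identity matrix of order $n$. *)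

(* Defs.v *)
From HB Require Import structures.
From mathcomp Require Import all_boot all_order all_algebra.

Set Implicit Arguments.
Unset Strict Implicit.
Unset Printing Implicit Defensive.

Import Order.TTheory GRing.Theory Num.Theory.
Local Open Scope ring_scope.

(* The sample space {1, ..., n} is represented by 'I_n = {0, ..., n-1}. *)
Definition prob (n : nat) (A : {set 'I_n}) : rat := #|A|%:R / n%:R.

Definition independent (n : nat) (A B : {set 'I_n}) : bool :=
  prob (A :&: B) == prob A * prob B.

(* Distinct events A_1, ..., A_t are given as the set {A_1, ..., A_t}, of
   cardinality t; no event is required to be independent of itself. *)
Definition pairwise_independent (n : nat) (F : {set {set 'I_n}}) : bool :=
  [forall A in F, forall B in F, (A != B) ==> independent A B].

Definition max_indep_events (n : nat) : nat :=
  (\max_(F : {set {set 'I_n}} | pairwise_independent F) #|F|)%N.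

Definition Hadamard (n : nat) (H : 'M[int]_n) : Prop :=
  (forall i j, H i j = 1 \/ H i j = -1) /\ H *m H^T = n%:R%:M.

(* Main.v *)
(** An event [A] other than [set0] and the whole space has a nonzero centred
indicator [n 1_A - |A|], which is orthogonal to the all-ones vector, and
independence of two events says that their centred indicators are orthogonal.
Orthogonal nonzero vectors of [Q^n] number at most [n], so besides [set0] there
are at most [n] events.  Conversely, fix a row [r] of a Hadamard matrix: the [n]
sets on which some row agrees with [r] are pairwise independent, and [set0] is
independent of every event. *)
Require Import Defs.
From mathcomp Require Import all_boot all_order all_algebra.
From mathcomp Require Import ring.

Set Implicit Arguments.
Unset Strict Implicit.
Unset Printing Implicit Defensive.

Import Order.TTheory GRing.Theory Num.Theory.
Local Open Scope ring_scope.

(** The Gram matrix [M *m M^T] is diagonal with nonzero entries, hence of rank [#|S|], while [M] has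
    only [n] columns. *)
Lemma orthogonal_card_le (K : fieldType) (I : finType) (n : nat) (S : {set I})
    (w : I -> 'rV[K]_n) :
  {in S &, forall a b, a != b -> \sum_j w a 0 j * w b 0 j = 0} ->
  {in S, forall a, \sum_j w a 0 j * w a 0 j != 0} ->
  (#|S| <= n)%N.
Proof.
move=> w_orth w_neq0.
pose M : 'M[K]_(#|S|, n) := \matrix_(i < #|S|) w (enum_val i).
pose d : 'rV[K]_#|S| := \row_i \sum_j w (enum_val i) 0 j * w (enum_val i) 0 j.
have MMt : M *m M^T = diag_mx d.
  apply/matrixP => i k; rewrite !mxE.
  under eq_bigr do rewrite !mxE.
  have [->|ik] := eqVneq i k; first by rewrite mulr1n.
  by rewrite mulr0n w_orth ?enum_valP // (inj_eq enum_val_inj).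
have : diag_mx d \in unitmx.
  rewrite unitmxE det_diag unitfE; apply/prodf_neq0 => i _.
  by rewrite mxE w_neq0 ?enum_valP.
move/mxrank_unit => rank_d.
by rewrite -[leqLHS]rank_d -MMt (leq_trans (mxrankM_maxl _ _)) ?rank_leq_col.
Qed.

Lemma sum_indicator (R : pzSemiRingType) (T : finType) (A : {set T}) :
  \sum_j (j \in A)%:R = #|A|%:R :> R.
Proof. by rewrite -natr_sum -sum1_card [in RHS]big_mkcond. Qed.

Section Events.

Variable n : nat.
Hypothesis n_gt0 : (0 < n)%N.
Implicit Types (A B : {set 'I_n}) (F : {set {set 'I_n}}).

Let n_neq0 : n%:R != 0 :> rat. Proof. by rewrite pnatr_eq0 -lt0n. Qed.

Lemma independentE A B :
  independent A B = (n%:R * #|A :&: B|%:R == #|A|%:R * #|B|%:R :> rat).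
Proof.
rewrite /independent /prob mulf_div eqr_div ?mulf_neq0 //.
by rewrite mulrA (inj_eq (mulIf n_neq0)) mulrC.
Qed.

Lemma independentC A B : independent A B = independent B A.
Proof. by rewrite !independentE setIC [X in _ == X]mulrC. Qed.

Lemma independent0 A : independent set0 A.
Proof. by rewrite independentE set0I cards0 mulr0 mul0r. Qed.

Lemma independentT A : independent setT A.
Proof. by rewrite independentE setTI cardsT card_ord. Qed.

Lemma pairwise_independentP F :
  reflect {in F &, forall A B, A != B -> independent A B}
          (pairwise_independent F).
Proof.
apply: (iffP forall_inP) => [FP A B FA FB|FP A FA].
  by move/forall_inP: (FP A FA) => /(_ B FB)/implyP.
by apply/forall_inP => B FB; apply/implyP; apply: FP.
Qed.

Lemma pairwise_independentU1 A F :
  (forall B, independent A B) -> pairwise_independent F ->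
  pairwise_independent (A |: F).
Proof.
move=> indA /pairwise_independentP indF; apply/pairwise_independentP => B C.
case/setU1P=> [->|FB] // /setU1P[->|FC]; first by rewrite independentC.
exact: indF.
Qed.

Definition centred A : 'rV[rat]_n :=
  \row_j (n%:R * (j \in A)%:R - #|A|%:R).

Lemma sum_centred A : \sum_j centred A 0 j = 0.
Proof.
under eq_bigr do rewrite mxE.
rewrite sumrB -mulr_sumr sum_indicator sumr_const card_ord.
by rewrite -[X in _ - X]mulr_natl subrr.
Qed.

Lemma dot_centred A B :
  \sum_j centred A 0 j * centred B 0 j =
  n%:R * (n%:R * #|A :&: B|%:R - #|A|%:R * #|B|%:R).
Proof.
(* The factor [centred A] is kept whole in the last term, so that its sum vanishes. *)
rewrite (eq_bigr (fun j => n%:R ^+ 2 * (j \in A :&: B)%:R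
    - #|A|%:R * (n%:R * (j \in B)%:R) - #|B|%:R * centred A 0 j)); last first.
  by move=> j _; rewrite !mxE inE -mulnb natrM; ring.
rewrite !sumrB -!mulr_sumr !sum_indicator sum_centred; ring.
Qed.

(* [centred setT] vanishes, which frees the index [setT] for the all-ones
   vector. *)
Definition event_vector A : 'rV[rat]_n :=
  if A == setT then const_mx 1 else centred A.

(** As [A] and [B] differ, at most one is [setT]; its all-ones vector is orthogonal to every vector
    with coordinate sum zero. *)
Lemma event_vector_orth A B : A != B -> independent A B ->
  \sum_j event_vector A 0 j * event_vector B 0 j = 0.
Proof.
rewrite /event_vector; have [->|_] := eqVneq A setT.
  rewrite eq_sym => /negbTE-> _.
  by under eq_bigr do rewrite [const_mx _ _ _]mxE mul1r; rewrite sum_centred.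
have [-> _ _|_ _] := eqVneq B setT.
  by under eq_bigr do rewrite [const_mx _ _ _]mxE mulr1; rewrite sum_centred.
by rewrite independentE dot_centred => /eqP->; rewrite subrr mulr0.
Qed.

(** The squared norm is [n] for [setT] and [n * (n - #|A|) * #|A|] otherwise. *)
Lemma event_vector_neq0 A : A != set0 ->
  \sum_j event_vector A 0 j * event_vector A 0 j != 0.
Proof.
move=> A0; rewrite /event_vector; have [_|AT] := eqVneq A setT.
  by under eq_bigr do rewrite mxE mul1r; rewrite sumr_const card_ord.
rewrite dot_centred setIid -mulrBl !mulf_neq0 ?n_neq0 //; last by rewrite pnatr_eq0 cards_eq0.
rewrite subr_eq0 eqr_nat; apply: contra AT => /eqP n_eq.
by rewrite eqEcard subsetT cardsT card_ord [leqLHS]n_eq leqnn.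
Qed.

Lemma pairwise_independent_card F : pairwise_independent F -> (#|F| <= n.+1)%N.
Proof.
move=> /(pairwise_independentU1 (independentT)) /pairwise_independentP indF.
have Fle : (#|(setT |: F) :\ set0| <= n)%N.
  apply: (@orthogonal_card_le _ _ _ _ event_vector) => [A B|A].
    move=> /setD1P[_ FA] /setD1P[_ FB] AB.
    by rewrite event_vector_orth ?indF.
  by case/setD1P => A0 _; apply: event_vector_neq0.
rewrite (leq_trans (subset_leq_card (subsetUr [set setT] F))) //.
(* The event [set0] accounts for the one unit beyond [n]. *)
by rewrite (cardsD1 set0) -add1n leq_add ?leq_b1.
Qed.

Section FromHadamard.

Variables (H : 'M[int]_n) (r : 'I_n).
Hypothesis H_Hadamard : Hadamard H.

(** Scaling each column by its entry in row [r] normalises [H]: row [r] becomes all ones and the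
    rows stay orthogonal. *)
Let x (i j : 'I_n) : rat := (H i j * H r j)%:~R.

Definition agreement_event (i : 'I_n) : {set 'I_n} := [set j | H i j == H r j].

Let Hsqr i j : H i j * H i j = 1.
Proof. by case: H_Hadamard => /(_ i j)[]->. Qed.

Let dotH i k : \sum_j H i j * H k j = n%:R *+ (i == k).
Proof.
case: H_Hadamard => _ /matrixP/(_ i k); rewrite !mxE => <-.
by apply: eq_bigr => j _; rewrite mxE.
Qed.

Let sum_x i : \sum_j x i j = n%:R * (i == r)%:R.
Proof. by rewrite -rmorph_sum /= dotH; case: (i == r); rewrite ?mulr1 ?mulr0 //= rmorph_nat. Qed.

Let sum_xx i k : \sum_j x i j * x k j = n%:R * (i == k)%:R.
Proof.
rewrite (eq_bigr (fun j => (H i j * H k j)%:~R)) => [|j _].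
  by rewrite -rmorph_sum /= dotH; case: (i == k); rewrite ?mulr1 ?mulr0 //= rmorph_nat.
by rewrite -rmorphM /= mulrACA Hsqr mulr1.
Qed.

Let indicatorE i j : (j \in agreement_event i)%:R = (1 + x i j) / 2%:R :> rat.
Proof.
rewrite inE /x; case: H_Hadamard => H1 _.
by case: (H1 i j) => ->; case: (H1 r j) => ->.
Qed.

(** Row [r] yields the whole space; any other row is orthogonal to row [r], so it agrees with it in
    exactly half of the columns. *)
Lemma card_agreement_event i :
  #|agreement_event i|%:R = n%:R * (1 + (i == r)%:R) / 2%:R :> rat.
Proof.
rewrite -sum_indicator; under eq_bigr do rewrite indicatorE.
by rewrite -mulr_suml big_split /= sum_x sumr_const card_ord mulrDr mulr1.
Qed.

Lemma agreement_event_neq0 i : agreement_event i != set0.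
Proof.
rewrite -cards_eq0 -(pnatr_eq0 rat) card_agreement_event.
by rewrite !mulf_neq0 ?n_neq0 // nat1r pnatr_eq0.
Qed.

Lemma agreement_event_inj : injective agreement_event.
Proof.
move=> i k eq_ik; have x_ik j : x i j = x k j.
  by move: (indicatorE i j); rewrite eq_ik indicatorE => /(divIf _) - /(_ isT)/addrI.
(* The right side is [n], whereas the left side would be 0 for distinct rows. *)
have: \sum_j x i j * x k j = \sum_j x k j * x k j.
  by apply: eq_bigr => j _; rewrite x_ik.
by rewrite !sum_xx eqxx => /(mulfI n_neq0); case: eqP.
Qed.

Lemma agreement_event_independent i k : i != k ->
  independent (agreement_event i) (agreement_event k).
Proof.
move=> ik; rewrite independentE !card_agreement_event -sum_indicator.
rewrite (eq_bigr (fun j => (1 + x i j + x k j + x i j * x k j) / 4%:R)) => [|j _].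
  rewrite -mulr_suml !big_split /= !sum_x sum_xx sumr_const card_ord (negbTE ik).
  (* The two sides differ by a multiple of [(i == r) * (k == r)], which is 0 because [i != k]. *)
  have [ir|_] /= := eqVneq i r; last by apply/eqP; field.
  by rewrite -ir (eq_sym k) (negbTE ik) /=; apply/eqP; field.
by rewrite inE -mulnb natrM !indicatorE; field.
Qed.

Lemma Hadamard_events :
  exists2 F : {set {set 'I_n}}, pairwise_independent F & #|F| = n.+1.
Proof.
exists (set0 |: [set agreement_event i | i : 'I_n]).
  apply: pairwise_independentU1; first exact: independent0.
  apply/pairwise_independentP => _ _ /imsetP[i _ ->] /imsetP[k _ ->].
  by rewrite (inj_eq agreement_event_inj); apply: agreement_event_independent.
rewrite cardsU1 card_imset ?card_ord; last exact: agreement_event_inj.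
suff -> : set0 \notin [set agreement_event i | i : 'I_n] by [].
apply/imsetP => -[i _ /esym/eqP].
by rewrite (negbTE (agreement_event_neq0 i)).
Qed.

End FromHadamard.

End Events.

Theorem theorem2p2 (n : nat) (n_gt0 : (0 < n)%N) :
  (max_indep_events n <= n + 1)%N /\
  ((exists H : 'M[int]_n, Hadamard H) -> max_indep_events n = (n + 1)%N).
Proof.
have le_n1 : (max_indep_events n <= n + 1)%N.
  by apply/bigmax_leqP => F /(pairwise_independent_card n_gt0); rewrite addn1.
split=> // -[H HH]; apply/eqP; rewrite eqn_leq le_n1 addn1.
(* Any row can serve as the reference row; positivity of [n] provides the first one. *)
have [F indF <-] := Hadamard_events n_gt0 (Ordinal n_gt0) HH.
exact: (@leq_bigmax_cond _ _ (fun F : {set {set 'I_n}} => #|F|)).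
Qed.
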